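(* The pure braid group $P_4$ is generated by the elements $c_{11},c_{21},c_{12},c_{31},c_{22},c_{13}$ and is defined by the relations (where $\varepsilon=\pm1$): $$c_{21}^{c_{11}^{\varepsilon}}=c_{21},\quad c_{12}^{c_{11}^{\varepsilon}}=c_{12}^{c_{21}^{-\varepsilon}},\quad c_{31}^{c_{11}^{\varepsilon}}=c_{31},\quad c_{22}^{c_{11}^{\varepsilon}}=c_{22},\quad c_{13}^{c_{11}^{\varepsilon}}=c_{13}^{c_{22}^{-\varepsilon}},$$ $$c_{31}^{c_{21}^{\varepsilon}}=c_{31},\quad c_{22}^{c_{21}^{\varepsilon}}=c_{22}^{c_{31}^{-\varepsilon}},\quad c_{13}^{c_{21}^{\varepsilon}}=c_{13}^{c_{22}^{\varepsilon}c_{31}^{-\varepsilon}},$$ $$c_{31}^{c_{12}^{\varepsilon}}=c_{31},\quad c_{13}^{c_{12}^{\varepsilon}}=c_{13}^{c_{31}^{-\varepsilon}},$$ $$c_{22}^{c_{12}^{-1}}=[c_{31},c_{13}^{-1}]\,[c_{13}^{-1},c_{22}]\,c_{22}\,[c_{21}^{2},c_{12}^{-1}]=c_{13}^{c_{31}}\,c_{13}^{-c_{22}}\,c_{22}\,[c_{21}^{2},c_{12}^{-1}],$$ $$c_{22}^{c_{12}}=[c_{12},c_{21}^{-2}]\,c_{22}\,[c_{22}^{-1},c_{13}]\,[c_{13},c_{31}^{-1}]=[c_{12},c_{21}^{-2}]\,c_{13}^{-c_{22}^{-2}}\,c_{22}\,c_{13}^{c_{31}^{-1}}.$$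
   Context: Conventions: $x^{y}=y^{-1}xy$, $x^{-y}=(x^{y})^{-1}$, $[x,y]=x^{-1}y^{-1}xy$. $P_4$ is the Artin pure braid group on $4$ strands, the kernel of $B_4\to S_4$, where $B_4$ is the braid group with standard generators $\sigma_1,\sigma_2,\sigma_3$. Its standard generators are $A_{i,i+1}=\sigma_i^2$ and $A_{ij}=\sigma_{j-1}\sigma_{j-2}\cdots\sigma_{i+1}\sigma_i^2\sigma_{i+1}^{-1}\cdots\sigma_{j-2}^{-1}\sigma_{j-1}^{-1}$ for $i+1<j$. The cabled generators (obtained by cabling strands of $c_{11}=\sigma_1^{-2}$) are $c_{11}=A_{12}^{-1}$, $c_{21}=A_{23}^{-1}A_{13}^{-1}$, $c_{12}=A_{13}^{-1}A_{12}^{-1}$, $c_{31}=A_{34}^{-1}A_{24}^{-1}A_{14}^{-1}$, $c_{22}=A_{24}^{-1}A_{14}^{-1}A_{23}^{-1}A_{13}^{-1}$, $c_{13}=A_{14}^{-1}A_{13}^{-1}A_{12}^{-1}$. *)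

(* Defs.v *)
From HB Require Import structures.
From mathcomp Require Import all_boot all_fingroup boolp.
(* [repr] must be that of quotients, not the one of [fingroup]. *)
From mathcomp Require Import generic_quotient.

Set Implicit Arguments.
Unset Strict Implicit.
Unset Printing Implicit Defensive.

Local Open Scope group_scope.
Local Open Scope quotient_scope.

(* [(x, true)] stands for the letter [x] and [(x, false)] for [x^-1]. *)
Definition word (X : Type) := seq (X * bool).

HB.instance Definition _ (X : Type) := gen_eqMixin (word X).
HB.instance Definition _ (X : Type) := gen_choiceMixin (word X).

Inductive free_eq (X : Type) : word X -> word X -> Prop :=
| free_eq_refl u : free_eq u u
| free_eq_sym u v : free_eq u v -> free_eq v u
| free_eq_trans u v w : free_eq u v -> free_eq v w -> free_eq u w
| free_eq_cancel (u v : word X) x b :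
    free_eq (u ++ (x, b) :: (x, ~~ b) :: v) (u ++ v).

Section FreeGroup.
Variable X : Type.
Implicit Types u v w : word X.

Definition free_eqb u v : bool := `[< free_eq u v >].

Lemma free_eqb_refl : reflexive free_eqb.
Proof. by move=> u; apply/asboolP; apply: free_eq_refl. Qed.

Lemma free_eqb_sym : symmetric free_eqb.
Proof. by move=> u v; apply/asboolP/asboolP; apply: free_eq_sym. Qed.

Lemma free_eqb_trans : transitive free_eqb.
Proof.
by move=> v u w /asboolP uv /asboolP vw; apply/asboolP; apply: free_eq_trans vw.
Qed.

Canonical free_equiv :=
  EquivRel free_eqb free_eqb_refl free_eqb_sym free_eqb_trans.

Definition freeGroup := {eq_quot free_equiv}.

HB.instance Definition _ := Choice.on freeGroup.
HB.instance Definition _ := EqQuotient.on freeGroup.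

Lemma free_piP u v : reflect (free_eq u v) (\pi_freeGroup u == \pi_freeGroup v).
Proof. by rewrite eqmodE; apply: asboolP. Qed.

Lemma free_eq_pi u v : free_eq u v -> \pi_freeGroup u = \pi_freeGroup v.
Proof. by move=> /free_piP/eqP. Qed.

Lemma free_eq_repr u : free_eq (repr (\pi_freeGroup u)) u.
Proof. by apply/free_piP; rewrite reprK. Qed.

Lemma free_eq_catl w u v : free_eq u v -> free_eq (w ++ u) (w ++ v).
Proof.
elim=> {u v} [u|u v _|u v t _ uv _ vt|u v x b].
- exact: free_eq_refl.
- exact: free_eq_sym.
- exact: free_eq_trans vt.
- by rewrite !catA; apply: free_eq_cancel.
Qed.

Lemma free_eq_catr w u v : free_eq u v -> free_eq (u ++ w) (v ++ w).
Proof.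
elim=> {u v} [u|u v _|u v t _ uv _ vt|u v x b].
- exact: free_eq_refl.
- exact: free_eq_sym.
- exact: free_eq_trans vt.
- by rewrite -!catA; apply: free_eq_cancel.
Qed.

Lemma free_eq_cat u u' v v' :
  free_eq u u' -> free_eq v v' -> free_eq (u ++ v) (u' ++ v').
Proof.
move=> uu' vv'; apply: free_eq_trans (free_eq_catr _ uu') (free_eq_catl _ vv').
Qed.

Definition word_inv u : word X := rev [seq (a.1, ~~ a.2) | a <- u].

Lemma word_invK : involutive word_inv.
Proof.
move=> u; rewrite /word_inv map_rev revK -map_comp -[RHS]map_id.
by apply: eq_map => -[x b] /=; rewrite negbK.
Qed.

Lemma word_inv_cat u v : word_inv (u ++ v) = word_inv v ++ word_inv u.
Proof. by rewrite /word_inv map_cat rev_cat. Qed.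

Lemma free_eq_inv u v : free_eq u v -> free_eq (word_inv u) (word_inv v).
Proof.
elim=> {u v} [u|u v _|u v t _ uv _ vt|u v x b].
- exact: free_eq_refl.
- exact: free_eq_sym.
- exact: free_eq_trans vt.
- rewrite !word_inv_cat /word_inv /= !rev_cons -!cats1 -!catA /= negbK.
  exact: free_eq_cancel.
Qed.

Lemma free_eq_mulVw u : free_eq (word_inv u ++ u) [::].
Proof.
elim: u => [|[x b] u IHu]; first exact: free_eq_refl.
rewrite /word_inv /= rev_cons -cats1 -catA /=.
apply: free_eq_trans IHu.
by rewrite -{2}[b]negbK; apply: free_eq_cancel.
Qed.

Definition free_one : freeGroup := \pi_freeGroup ([::] : word X).
Definition free_mul (p q : freeGroup) : freeGroup :=
  \pi_freeGroup (repr p ++ repr q : word X).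
Definition free_inv (p : freeGroup) : freeGroup := \pi_freeGroup (word_inv (repr p)).

Lemma free_mul_pi u v :
  free_mul (\pi_freeGroup u) (\pi_freeGroup v) = \pi_freeGroup (u ++ v : word X).
Proof. by apply: free_eq_pi; apply: free_eq_cat; apply: free_eq_repr. Qed.

Lemma free_inv_pi u :
  free_inv (\pi_freeGroup u) = \pi_freeGroup (word_inv u).
Proof. by apply: free_eq_pi; apply: free_eq_inv; apply: free_eq_repr. Qed.

Lemma free_mulA : associative free_mul.
Proof.
elim/quotW=> u; elim/quotW=> v; elim/quotW=> w.
by rewrite (free_mul_pi u v) (free_mul_pi v w) !free_mul_pi catA.
Qed.

Lemma free_mul1 : left_id free_one free_mul.
Proof. by elim/quotW=> u; rewrite free_mul_pi. Qed.

Lemma free_mulr1 : right_id free_one free_mul.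
Proof. by elim/quotW=> u; rewrite free_mul_pi cats0. Qed.

Lemma free_mulV : left_inverse free_one free_inv free_mul.
Proof.
elim/quotW=> u; rewrite free_inv_pi free_mul_pi.
by apply: free_eq_pi; apply: free_eq_mulVw.
Qed.

Lemma free_mulrV : right_inverse free_one free_inv free_mul.
Proof.
elim/quotW=> u; rewrite free_inv_pi free_mul_pi -{1}[u]word_invK.
by apply: free_eq_pi; apply: free_eq_mulVw.
Qed.

HB.instance Definition _ :=
  isGroup.Build freeGroup free_mulA free_mul1 free_mulr1 free_mulV free_mulrV.

Definition free_gen (x : X) : freeGroup := \pi_freeGroup ([:: (x, true)] : word X).

End FreeGroup.

(* [x ^^ true] is [x] and [x ^^ false] is [x^-1]. *)
Definition sgexp (G : groupType) (x : G) (b : bool) : G := if b then x else x^-1.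
Notation "x ^^ b" := (sgexp x b) (at level 30, right associativity) : group_scope.

Section FreeLift.
Variables (X : Type) (G : groupType) (g : X -> G).

Definition word_eval (w : word X) : G := \prod_(a <- w) g a.1 ^^ a.2.

Lemma word_eval_cat u v : word_eval (u ++ v) = word_eval u * word_eval v.
Proof. by rewrite /word_eval big_cat. Qed.

Lemma free_eq_eval u v : free_eq u v -> word_eval u = word_eval v.
Proof.
elim=> {u v} [//|//|u v w _ -> //|u v x b].
rewrite !word_eval_cat; congr (_ * _); rewrite /word_eval !big_cons /= mulgA.
by case: b => /=; rewrite ?mulgV ?mulVg mul1g.
Qed.

Definition free_lift (p : freeGroup X) : G := word_eval (repr p).

Lemma free_lift_pi u : free_lift (\pi_(freeGroup X) u) = word_eval u.
Proof. by apply: free_eq_eval; apply: free_eq_repr. Qed.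

Lemma free_lift_gen x : free_lift (free_gen x) = g x.
Proof. by rewrite free_lift_pi /word_eval big_seq1. Qed.

Lemma free_liftM : {morph free_lift : p q / p * q}.
Proof.
elim/quotW=> u; elim/quotW=> v.
by rewrite [_ * _]free_mul_pi !free_lift_pi word_eval_cat.
Qed.

Lemma free_lift1 : free_lift 1 = 1.
Proof. by rewrite [X in free_lift X]/(1) free_lift_pi /word_eval big_nil. Qed.

HB.instance Definition _ :=
  isUMagmaMorphism.Build (freeGroup X) G free_lift (conj free_lift1 free_liftM).

End FreeLift.

(* A relation [R u v] is to be read as the defining relation [u = v]. *)
Inductive normal_closure (G : groupType) (R : G -> G -> Prop) : G -> Prop :=
| normal_closure_rel u v : R u v -> normal_closure R (u * v^-1)
| normal_closure1 : normal_closure R 1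
| normal_closureM x y :
    normal_closure R x -> normal_closure R y -> normal_closure R (x * y)
| normal_closureV x : normal_closure R x -> normal_closure R x^-1
| normal_closureJ x y : normal_closure R x -> normal_closure R (x ^ y).

Section QuotientGroup.
Variables (G : groupType) (R : G -> G -> Prop).
Implicit Types x y z : G.

Definition quo_eqb x y : bool := `[< normal_closure R (x * y^-1) >].

Lemma quo_eqb_refl : reflexive quo_eqb.
Proof. by move=> x; apply/asboolP; rewrite mulgV; apply: normal_closure1. Qed.

Lemma quo_eqb_sym : symmetric quo_eqb.
Proof.
by move=> x y; apply/asboolP/asboolP=> /normal_closureV; rewrite invgM invgK.
Qed.

Lemma quo_eqb_trans : transitive quo_eqb.
Proof.
move=> y x z /asboolP xy /asboolP yz; apply/asboolP.
by have := normal_closureM xy yz; rewrite mulgA mulgKV.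
Qed.

Canonical quo_equiv := EquivRel quo_eqb quo_eqb_refl quo_eqb_sym quo_eqb_trans.

Definition quoGroup := {eq_quot quo_equiv}.

HB.instance Definition _ := Choice.on quoGroup.
HB.instance Definition _ := EqQuotient.on quoGroup.

Lemma quo_piP x y :
  reflect (normal_closure R (x * y^-1)) (\pi_quoGroup x == \pi_quoGroup y).
Proof. by rewrite eqmodE; apply: asboolP. Qed.

Lemma quo_repr x : normal_closure R (repr (\pi_quoGroup x) * x^-1).
Proof. by apply/quo_piP; rewrite reprK. Qed.

Definition quo_one : quoGroup := \pi_quoGroup 1.
Definition quo_mul (p q : quoGroup) : quoGroup := \pi_quoGroup (repr p * repr q).
Definition quo_inv (p : quoGroup) : quoGroup := \pi_quoGroup (repr p)^-1.

Lemma quo_mul_pi x y :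
  quo_mul (\pi_quoGroup x) (\pi_quoGroup y) = \pi_quoGroup (x * y).
Proof.
apply/eqP/quo_piP; set x' := repr _; set y' := repr _.
have -> : x' * y' * (x * y)^-1 = (x' * x^-1) * (y' * y^-1) ^ x^-1.
  by rewrite /conjg invgK invgM !mulgA mulgKV.
by apply: normal_closureM (quo_repr x) (normal_closureJ _ (quo_repr y)).
Qed.

Lemma quo_inv_pi x : quo_inv (\pi_quoGroup x) = \pi_quoGroup x^-1.
Proof.
apply/eqP/quo_piP; set x' := repr _.
have -> : x'^-1 * x^-1^-1 = ((x' * x^-1)^-1) ^ x.
  by rewrite /conjg invgK invgM invgK -!mulgA mulKg.
by apply: normal_closureJ; apply: normal_closureV; apply: quo_repr.
Qed.

Lemma quo_mulA : associative quo_mul.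
Proof.
elim/quotW=> x; elim/quotW=> y; elim/quotW=> z.
by rewrite (quo_mul_pi x y) (quo_mul_pi y z) !quo_mul_pi mulgA.
Qed.

Lemma quo_mul1 : left_id quo_one quo_mul.
Proof. by elim/quotW=> x; rewrite quo_mul_pi mul1g. Qed.

Lemma quo_mulr1 : right_id quo_one quo_mul.
Proof. by elim/quotW=> x; rewrite quo_mul_pi mulg1. Qed.

Lemma quo_mulV : left_inverse quo_one quo_inv quo_mul.
Proof. by elim/quotW=> x; rewrite quo_inv_pi quo_mul_pi mulVg. Qed.

Lemma quo_mulrV : right_inverse quo_one quo_inv quo_mul.
Proof. by elim/quotW=> x; rewrite quo_inv_pi quo_mul_pi mulgV. Qed.

HB.instance Definition _ :=
  isGroup.Build quoGroup quo_mulA quo_mul1 quo_mulr1 quo_mulV quo_mulrV.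

Definition quo_pi (x : G) : quoGroup := \pi_quoGroup x.

Lemma quo_piM : {morph quo_pi : x y / x * y}.
Proof. by move=> x y; rewrite [RHS]quo_mul_pi. Qed.

HB.instance Definition _ :=
  isUMagmaMorphism.Build G quoGroup quo_pi (conj (erefl _) quo_piM).

Lemma quo_pi_eq1 x : quo_pi x = 1 <-> normal_closure R x.
Proof.
split=> [/eqP/quo_piP|x1]; first by rewrite invg1 mulg1.
by apply/eqP/quo_piP; rewrite invg1 mulg1.
Qed.

Lemma quo_pi_rel x y : R x y -> quo_pi x = quo_pi y.
Proof. by move=> Rxy; apply/eqP/quo_piP; apply: normal_closure_rel. Qed.

End QuotientGroup.

Section QuotientLift.
Variables (G H : groupType) (R : G -> G -> Prop) (f : UMagmaMorphism.type G H).
Hypothesis fR : forall x y, R x y -> f x = f y.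

Lemma normal_closure_ker x : normal_closure R x -> f x = 1.
Proof.
elim=> {x} [x y /fR fxy||x y _ fx _ fy|x _ fx|x y _ fx].
- by rewrite gmulfM gmulfV fxy mulgV.
- exact: gmulf1.
- by rewrite gmulfM fx fy mulg1.
- by rewrite gmulfV fx invg1.
- by rewrite gmulfJ fx conj1g.
Qed.

Lemma quo_lift_pi x : f (repr (quo_pi R x)) = f x.
Proof.
have /normal_closure_ker := quo_repr R x.
by rewrite gmulfM gmulfV => /(congr1 (mul^~ (f x))); rewrite mulgKV mul1g.
Qed.

End QuotientLift.

Section Presentation.
Variables (X : Type) (R : freeGroup X -> freeGroup X -> Prop).

Definition presGroup := quoGroup R.

HB.instance Definition _ := Group.on presGroup.

Definition pres_gen (x : X) : presGroup := quo_pi R (free_gen x).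

(* This is the homomorphism sending each [pres_gen x] to [g x] only when [g]
   satisfies the relations [R]; see [pres_lift_gen] and [pres_liftM]. *)
Definition pres_lift (H : groupType) (g : X -> H) (p : presGroup) : H :=
  free_lift g (repr p).

Section Lift.
Variables (H : groupType) (g : X -> H).
Hypothesis gR : forall u v, R u v -> free_lift g u = free_lift g v.

Lemma pres_lift_pi u : pres_lift g (quo_pi R u) = free_lift g u.
Proof. exact: quo_lift_pi gR u. Qed.

Lemma pres_lift_gen x : pres_lift g (pres_gen x) = g x.
Proof. by rewrite pres_lift_pi free_lift_gen. Qed.

Lemma pres_liftM : {morph pres_lift g : p q / p * q}.
Proof.
elim/quotW=> u; elim/quotW=> v.
rewrite -/(quo_pi R u) -/(quo_pi R v) -[_ * _ in LHS]quo_piM.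
by rewrite !pres_lift_pi free_liftM.
Qed.

End Lift.
End Presentation.

(* The subgroup [P] of [G] is generated by the family [g] and defined by the
   relations [R]: the canonical homomorphism from the free group has image [P]
   and kernel the normal closure of the relators. *)
Definition presented_by (X : Type) (G : groupType) (P : {pred G}) (g : X -> G)
    (R : freeGroup X -> freeGroup X -> Prop) : Prop :=
  (forall p : G, p \in P <-> exists w : freeGroup X, free_lift g w = p) /\
  (forall w : freeGroup X, free_lift g w = 1 <-> normal_closure R w).

(* Generators are numbered from 0: [free_gen i] is the usual sigma_(i+1). *)
Inductive braid_rel (n : nat) : freeGroup 'I_n -> freeGroup 'I_n -> Prop :=
| braid_rel_far (i j : 'I_n) : i.+1 < j ->
    braid_rel (free_gen i * free_gen j) (free_gen j * free_gen i)
| braid_rel_near (i j : 'I_n) : i.+1 = j ->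
    braid_rel (free_gen i * free_gen j * free_gen i)
              (free_gen j * free_gen i * free_gen j).

(* The braid group on [n.+1] strands. *)
Definition braidGroup (n : nat) := presGroup (@braid_rel n).

HB.instance Definition _ (n : nat) := Group.on (braidGroup n).

Definition sigma (n : nat) (i : 'I_n) : braidGroup n := pres_gen (@braid_rel n) i.

Definition adj_tperm (n : nat) (i : 'I_n) : 'S_n.+1 :=
  tperm (widen_ord (leqnSn n) i) (lift ord0 i).

Definition braid_perm (n : nat) (b : braidGroup n) : 'S_n.+1 :=
  pres_lift (@adj_tperm n) b.

Lemma adj_tperm_rel n u v :
  @braid_rel n u v -> free_lift (@adj_tperm n) u = free_lift (@adj_tperm n) v.
Proof.
case=> i j ij; rewrite !free_liftM !free_lift_gen /adj_tperm.
  have neq (x y : 'I_n.+1) : (x < y)%N -> y != x.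
    by move=> xy; rewrite -val_eqE neq_ltn xy orbT.
  have ij' : (i < j)%N by apply: ltn_trans ij.
  apply/commgP/conjg_fixP.
  by rewrite tpermJ !tpermD // neq //= /bump ?add1n ?ltnS // ltnW.
have -> : widen_ord (leqnSn n) j = lift ord0 i by apply/val_inj; rewrite /= -ij.
set a := widen_ord _ i; set b : 'I_n.+1 := lift ord0 i.
set c : 'I_n.+1 := lift ord0 j.
have ca : c != a by rewrite -val_eqE /= /bump /= -ij !add1n neq_ltn ltnS leqnSn orbT.
have cb : c != b by rewrite -val_eqE /= /bump /= -ij !add1n neq_ltn ltnSn orbT.
have ab : a != b by rewrite -val_eqE /= /bump /= add1n neq_ltn ltnSn.
have tJ (x y z t : 'I_n.+1) :
    tperm x y * tperm z t * tperm x y = tperm (tperm x y z) (tperm x y t).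
  by rewrite -tpermJ /conjg tpermV mulgA.
have tac : tperm a b c = c by apply: tpermD; rewrite eq_sym.
have tba : tperm b c a = a by apply: tpermD; rewrite // eq_sym.
by rewrite !tJ tpermR tpermL tac tba.
Qed.

Lemma braid_permM n : {morph @braid_perm n : x y / x * y}.
Proof. exact: (pres_liftM (@adj_tperm_rel n)). Qed.

Lemma braid_perm_sigma n (i : 'I_n) : braid_perm (sigma i) = adj_tperm i.
Proof. exact: (pres_lift_gen (@adj_tperm_rel n)). Qed.

Definition pure_braid (n : nat) : {pred braidGroup n} :=
  [pred b : braidGroup n | braid_perm b == 1].

Section PureBraid4.

Let s1 : braidGroup 3 := sigma (Ordinal (isT : 0 < 3)).
Let s2 : braidGroup 3 := sigma (Ordinal (isT : 1 < 3)).
Let s3 : braidGroup 3 := sigma (Ordinal (isT : 2 < 3)).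

Definition A12 := s1 ^+ 2.
Definition A23 := s2 ^+ 2.
Definition A34 := s3 ^+ 2.
Definition A13 := s2 * s1 ^+ 2 * s2^-1.
Definition A24 := s3 * s2 ^+ 2 * s3^-1.
Definition A14 := s3 * s2 * s1 ^+ 2 * s2^-1 * s3^-1.

End PureBraid4.

Variant cabled := C11 | C21 | C12 | C31 | C22 | C13.

Definition cabled_braid (c : cabled) : braidGroup 3 :=
  match c with
  | C11 => A12^-1
  | C21 => A23^-1 * A13^-1
  | C12 => A13^-1 * A12^-1
  | C31 => A34^-1 * A24^-1 * A14^-1
  | C22 => A24^-1 * A14^-1 * A23^-1 * A13^-1
  | C13 => A14^-1 * A13^-1 * A12^-1
  end.

Section CabledRelations.

Let c11 := free_gen C11.
Let c21 := free_gen C21.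
Let c12 := free_gen C12.
Let c31 := free_gen C31.
Let c22 := free_gen C22.
Let c13 := free_gen C13.

(* The boolean [e] is the sign: true for epsilon = 1, false for epsilon = -1. *)
Inductive cabled_rel : freeGroup cabled -> freeGroup cabled -> Prop :=
| rel_c21_c11 e : cabled_rel (c21 ^ (c11 ^^ e)) c21
| rel_c12_c11 e : cabled_rel (c12 ^ (c11 ^^ e)) (c12 ^ (c21 ^^ (~~ e)))
| rel_c31_c11 e : cabled_rel (c31 ^ (c11 ^^ e)) c31
| rel_c22_c11 e : cabled_rel (c22 ^ (c11 ^^ e)) c22
| rel_c13_c11 e : cabled_rel (c13 ^ (c11 ^^ e)) (c13 ^ (c22 ^^ (~~ e)))
| rel_c31_c21 e : cabled_rel (c31 ^ (c21 ^^ e)) c31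
| rel_c22_c21 e : cabled_rel (c22 ^ (c21 ^^ e)) (c22 ^ (c31 ^^ (~~ e)))
| rel_c13_c21 e :
    cabled_rel (c13 ^ (c21 ^^ e)) (c13 ^ (c22 ^^ e * c31 ^^ (~~ e)))
| rel_c31_c12 e : cabled_rel (c31 ^ (c12 ^^ e)) c31
| rel_c13_c12 e : cabled_rel (c13 ^ (c12 ^^ e)) (c13 ^ (c31 ^^ (~~ e)))
| rel_c22_c12V_comm :
    cabled_rel (c22 ^ c12^-1)
      ([~ c31, c13^-1] * [~ c13^-1, c22] * c22 * [~ c21 ^+ 2, c12^-1])
| rel_c22_c12V_conj :
    cabled_rel (c22 ^ c12^-1)
      (c13 ^ c31 * (c13 ^ c22)^-1 * c22 * [~ c21 ^+ 2, c12^-1])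
| rel_c22_c12_comm :
    cabled_rel (c22 ^ c12)
      ([~ c12, c21 ^- 2] * c22 * [~ c22^-1, c13] * [~ c13, c31^-1])
| rel_c22_c12_conj :
    cabled_rel (c22 ^ c12)
      ([~ c12, c21 ^- 2] * (c13 ^ (c22 ^- 2))^-1 * c22 * c13 ^ c31^-1).

End CabledRelations.

(* Main.v *)
From HB Require Import structures.
From mathcomp Require Import all_boot all_fingroup boolp.
Require Import Defs.

(* Put x = c12 c13^-1, y = c21 c22^-1, z = c31^-1; in B4 these are A14, A14 A24 and
   A14 A24 A34. The cabled relations are equivalent to rules giving the conjugates
   of x, y, z by c11, c21, c12 as words in x, y, z, and those of c21, c12 by c11 as
   words in c21, c12. With these rules every word can be combed into the shape of
   an element of (F3 x| F2) x| Z, which makes equalities checkable by computation.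
   In B4 the rules follow from the conjugation action of s1 and s2 on x, y, z.
   Conversely, let G be the group presented by the cabled relations. The
   Reidemeister-Schreier rewriting of B4 along 24 coset representatives of P4 is
   an action of B4 on G x (cosets): checking it amounts to combing the 72 rewritten
   braid relations. A word in the cabled generators acts on (1, P4) by its value in
   G, so a word that is trivial in B4 is trivial in G. *)

Set Implicit Arguments.
Unset Strict Implicit.
Unset Printing Implicit Defensive.

Local Open Scope group_scope.
Local Open Scope quotient_scope.

(** * Identities of free groups and evaluation of words *)

Ltac free_group :=
  by rewrite /conjg /commg !(invgM, invgK, invg1, mulgA, mulgK, mulgKV, mulVg,
       mulgV, mul1g, mulg1).

Lemma conj_fix_sym (H : groupType) (p q : H) : p ^ q = p -> q ^ p = q.
Proof. by rewrite /conjg => pq; rewrite -{2}pq; free_group. Qed.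

Lemma sgexpN (G : groupType) (x : G) e : x ^^ (~~ e) = (x ^^ e)^-1.
Proof. by case: e; rewrite /= ?invgK. Qed.

Lemma word_evalV (X : Type) (G : groupType) (g : X -> G) (w : word X) :
  word_eval g (word_inv w) = (word_eval g w)^-1.
Proof.
apply: (mulIg (word_eval g w)).
rewrite -word_eval_cat mulVg (free_eq_eval g (free_eq_mulVw w)).
by rewrite /word_eval big_nil.
Qed.

Lemma word_eval_cons (X : Type) (G : groupType) (g : X -> G) a (w : word X) :
  word_eval g (a :: w) = g a.1 ^^ a.2 * word_eval g w.
Proof. by rewrite /word_eval big_cons. Qed.

Lemma word_eval_nil (X : Type) (G : groupType) (g : X -> G) :
  word_eval g [::] = 1.
Proof. by rewrite /word_eval big_nil. Qed.

Lemma word_eval_seq1 (X : Type) (G : groupType) (g : X -> G) x e :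
  word_eval g [:: (x, e)] = g x ^^ e.
Proof. by rewrite /word_eval big_seq1. Qed.

Lemma morph_mul1 (G H : groupType) (f : G -> H) : {morph f : x y / x * y} -> f 1 = 1.
Proof. by move=> fM; apply: (mulgI (f 1)); rewrite -fM !mulg1. Qed.

Lemma morph_mulV (G H : groupType) (f : G -> H) :
  {morph f : x y / x * y} -> {morph f : x / x^-1}.
Proof.
by move=> fM x; apply: (mulgI (f x)); rewrite -fM !mulgV (morph_mul1 fM).
Qed.

Lemma morph_word_eval (X : Type) (G H : groupType) (f : G -> H) (g : X -> G) w :
  {morph f : x y / x * y} -> f (word_eval g w) = word_eval (f \o g) w.
Proof.
move=> fM; elim: w => [|[x e] w IHw].
  by rewrite !word_eval_nil (morph_mul1 fM).
by rewrite !word_eval_cons fM IHw; case: e; rewrite //= (morph_mulV fM).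
Qed.

(** * Combing of words in six letters *)

(* To be interpreted as A14, A14 A24, A14 A24 A34, c12, c21, c11 respectively; see
   [letter_val] and [artin_letters]. *)
Variant letter := U1 | U2 | U3 | V1 | V2 | T.

(** The levels F3, F2 and Z of the combed shape: by [twist], a letter normalises the subgroup
    generated by any level of lower rank. *)
Definition rank (l : letter) : nat :=
  match l with U1 | U2 | U3 => 0 | V1 | V2 => 1 | T => 2 end.

(* When [rank m < rank l], this is the conjugate of [m] by [l ^^ e]. *)
Definition twist (l : letter) (e : bool) (m : letter) : word letter :=
  match l, m with
  | T, U1 => [:: (U2, ~~ e); (U1, true); (U2, e)]
  | V2, U1 => [:: (U3, ~~ e); (U2, e); (U1, true); (U2, ~~ e); (U3, e)]
  | V1, U1 => [:: (U3, ~~ e); (U1, true); (U3, e)]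
  | V2, U2 => [:: (U3, ~~ e); (U2, true); (U3, e)]
  | V1, U2 =>
      if e then [:: (U1, false); (U2, true); (U3, false); (U1, true); (U3, true)]
      else [:: (U3, true); (U1, true); (U3, false); (U2, true); (U1, false)]
  | T, V1 => [:: (V2, e); (V1, true); (V2, ~~ e)]
  | _, _ => [:: (m, true)]
  end.

Definition comb_rules (H : groupType) (v : letter -> H) : Prop :=
  forall l e m, rank m < rank l -> v m ^ (v l ^^ e) = word_eval v (twist l e m).

(* The case [e = true] of [comb_rules], which implies the case [e = false]. *)
Variant half_rules (H : groupType) (x y z c b a : H) : Prop :=
  HalfRules of z ^ a = z & z ^ b = z & z ^ c = z
    & y ^ a = y & y ^ b = y ^ z & y ^ c = x^-1 * y * x ^ z
    & x ^ a = x ^ y & x ^ b = x ^ (y^-1 * z) & x ^ c = x ^ z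
    & b ^ a = b & c ^ a = c ^ b^-1.

(** Conjugation by an inverse letter is found by inverting the rules one after another, each time
    with the rules already known for the letters of the right-hand side. *)
Lemma half_rules_comb (H : groupType) (v : letter -> H) :
  half_rules (v U1) (v U2) (v U3) (v V1) (v V2) (v T) -> comb_rules v.
Proof.
case; set x := v U1; set y := v U2; set z := v U3; set c := v V1; set b := v V2.
set a := v T => za zb zc ya yb yc xa xb xc ba ca l e m.
have inv (k p q : H) : q ^ k = p -> p ^ k^-1 = q by move<-; rewrite conjgK.
have zaV := inv _ _ _ za; have zbV := inv _ _ _ zb; have zcV := inv _ _ _ zc.
have yaV := inv _ _ _ ya; have baV := inv _ _ _ ba.
have ybV : y ^ b^-1 = y ^ z^-1 by apply: inv; rewrite conjJg yb conjVg zb conjgK.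
have xaV : x ^ a^-1 = x ^ y^-1 by apply: inv; rewrite conjJg xa conjVg ya conjgK.
have xcV : x ^ c^-1 = x ^ z^-1 by apply: inv; rewrite conjJg xc conjVg zc conjgK.
have xbV : x ^ b^-1 = x ^ (y * z^-1).
  by apply: inv; rewrite conjJg xb conjMg conjVg yb zb; free_group.
have ycV : y ^ c^-1 = x ^ z^-1 * y * x^-1.
  apply: inv; rewrite !conjMg !conjVg xc zc yc; free_group.
have caV : c ^ a^-1 = c ^ b by apply: inv; rewrite conjJg ca ba conjgKV.
by case: l; case: m => // _; case: e => /=;
  rewrite !word_eval_cons word_eval_nil /= -/x -/y -/z -/a -/b -/c
    ?(za, zb, zc, zaV, zbV, zcV, ya, yb, yc, yaV, ybV, ycV, xa, xb, xc,
      xaV, xbV, xcV, ba, ca, baV, caV); free_group.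
Qed.

Definition letter_eqb (l m : letter) : bool :=
  match l, m with
  | U1, U1 | U2, U2 | U3, U3 | V1, V1 | V2, V2 | T, T => true
  | _, _ => false
  end.

Lemma letter_eqb_eq l m : letter_eqb l m -> l = m.
Proof. by case: l; case: m. Qed.

Definition cancel_cons (a : letter * bool) (w : word letter) : word letter :=
  if w is b :: w' then
    if letter_eqb a.1 b.1 && (a.2 != b.2) then w' else a :: w
  else [:: a].

(* A combed word lists its letters by increasing rank. It need not be canonical for
   what follows, as only soundness is used. *)
Fixpoint comb_cons (a : letter * bool) (w : word letter) : word letter :=
  if w is b :: w' then
    if rank b.1 < rank a.1 then
      let t := twist a.1 (~~ a.2) b.1 in
      foldr cancel_cons (comb_cons a w') (if b.2 then t else word_inv t)
    else cancel_cons a w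
  else [:: a].

Definition comb (w : word letter) : word letter := foldr comb_cons [::] w.

Section CombSound.
Variables (H : groupType) (v : letter -> H).
Hypothesis vP : comb_rules v.

Lemma cancel_consE a w : word_eval v (cancel_cons a w) = word_eval v (a :: w).
Proof.
case: w a => [|[m d] w] [l e] //=; case: ifP => // /andP[/letter_eqb_eq -> de].
have -> : e = ~~ d by case: e d de => [] [].
by rewrite !word_eval_cons /= sgexpN mulKg.
Qed.

Lemma foldr_cancel_consE u w :
  word_eval v (foldr cancel_cons w u) = word_eval v u * word_eval v w.
Proof.
elim: u => [|a u IHu]; first by rewrite word_eval_nil mul1g.
by rewrite /= cancel_consE !word_eval_cons IHu mulgA.
Qed.

(** A letter [a] passes a letter [b] of lower rank by [a * b = b ^ a^-1 * a], whence the negated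
    sign in the twist. *)
Lemma comb_consE a w : word_eval v (comb_cons a w) = word_eval v (a :: w).
Proof.
case: a => l e; elim: w => [//|[m d] w IHw] /=; case: ifP => [lm|_]; last first.
  by rewrite (cancel_consE (l, e) ((m, d) :: w)).
rewrite foldr_cancel_consE IHw !word_eval_cons /=.
have -> : word_eval v (if d then twist l (~~ e) m else word_inv (twist l (~~ e) m))
        = (v m ^^ d) ^ (v l ^^ e)^-1.
  rewrite -sgexpN.
  by case: d; rewrite ?word_evalV -vP //= conjVg.
by rewrite /conjg invgK !mulgA mulgKV.
Qed.

Lemma combE w : word_eval v (comb w) = word_eval v w.
Proof. by elim: w => //= a w IHw; rewrite comb_consE !word_eval_cons IHw. Qed.

Lemma comb_inj u w : comb u = comb w -> word_eval v u = word_eval v w.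
Proof. by move=> uw; rewrite -combE uw combE. Qed.

End CombSound.

(** * Equivalence of the cabled relations with the combing rules *)

Definition letter_val (H : groupType) (f : cabled -> H) (l : letter) : H :=
  match l with
  | U1 => f C12 * (f C13)^-1
  | U2 => f C21 * (f C22)^-1
  | U3 => (f C31)^-1
  | V1 => f C12
  | V2 => f C21
  | T => f C11
  end.

Definition cabled_letters (c : cabled) : word letter :=
  match c with
  | C11 => [:: (T, true)]
  | C21 => [:: (V2, true)]
  | C12 => [:: (V1, true)]
  | C31 => [:: (U3, false)]
  | C22 => [:: (U2, false); (V2, true)]
  | C13 => [:: (U1, false); (V1, true)]
  end.

Lemma cabled_lettersE (H : groupType) (f : cabled -> H) c :
  word_eval (letter_val f) (cabled_letters c) = f c.
Proof. by case: c; rewrite !word_eval_cons word_eval_nil /=; free_group. Qed.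

Ltac plain_relation R :=
  by have := R; rewrite /= !(gmulfJ, gmulfM, gmulfV, gmulfR, gmulfXn) /= !free_lift_gen.

(** Most rules restate short relations. The substantial ones are those for [x ^ a], [x ^ b] and
    [y ^ c]: the short relations give [x ^ b] in terms of [a], and the long relation then trades [a]
    for [y]. *)
Lemma cabled_rel_comb (H : groupType) (f : cabled -> H) :
  (forall u v, cabled_rel u v -> free_lift f u = free_lift f v) ->
  comb_rules (letter_val f).
Proof.
move=> fR; apply: half_rules_comb => /=.
set a := f C11; set b := f C21; set c := f C12; set c31 := f C31.
set c22 := f C22; set c13 := f C13; set x := c * _; set y := b * _; set z := c31^-1.
have inv (k p q : H) : q ^ k = p -> p ^ k^-1 = q by move<-; rewrite conjgK.
have ba : b ^ a = b by plain_relation (fR _ _ (rel_c21_c11 true)).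
have ca : c ^ a = c ^ b^-1 by plain_relation (fR _ _ (rel_c12_c11 true)).
have c31a : c31 ^ a = c31 by plain_relation (fR _ _ (rel_c31_c11 true)).
have c22a : c22 ^ a = c22 by plain_relation (fR _ _ (rel_c22_c11 true)).
have c13a : c13 ^ a = c13 ^ c22^-1 by plain_relation (fR _ _ (rel_c13_c11 true)).
have c31b : c31 ^ b = c31 by plain_relation (fR _ _ (rel_c31_c21 true)).
have c22b : c22 ^ b = c22 ^ z by plain_relation (fR _ _ (rel_c22_c21 true)).
have c13b : c13 ^ b = c13 ^ (c22 * z) by plain_relation (fR _ _ (rel_c13_c21 true)).
have c31c : c31 ^ c = c31 by plain_relation (fR _ _ (rel_c31_c12 true)).
have c13c : c13 ^ c = c13 ^ z by plain_relation (fR _ _ (rel_c13_c12 true)).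
have c22c : c22 ^ c = [~ c, b ^- 2] * (c13 ^ (c22 ^- 2))^-1 * c22 * c13 ^ z.
  by plain_relation (fR _ _ rel_c22_c12_conj).
have za : z ^ a = z by rewrite conjVg c31a.
have zb : z ^ b = z by rewrite conjVg c31b.
have zc : z ^ c = z by rewrite conjVg c31c.
have ya : y ^ a = y by rewrite conjMg conjVg ba c22a.
have yb : y ^ b = y ^ z.
  by rewrite !conjMg !conjVg c22b (conj_fix_sym zb); free_group.
have xc : x ^ c = x ^ z by rewrite !conjMg !conjVg c13c (conj_fix_sym zc); free_group.
have caV : c ^ a^-1 = c ^ b by apply: inv; rewrite conjJg ca ba conjgKV.
have c13aV : c13 ^ a^-1 = c13 ^ c22 by apply: inv; rewrite conjJg c13a c22a conjgKV.
(* Both [c] and [c13] are conjugated by [b] as by [a^-1 * z]; for [c] this uses that [z] commutes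
   with [c] and [b]. *)
have xb : x ^ b = x ^ (a^-1 * z).
  rewrite !conjMg !conjVg !conjgM caV c13aV conjJg (conj_fix_sym zc) (conj_fix_sym zb).
  by rewrite c13b conjgM.
(* This is what the long relation for [c22 ^ c12] amounts to. *)
have xaac22 : x ^ (a * a * c22) = x ^ z.
  have caa : c ^ (a * a) = c ^ (b ^- 2).
    by rewrite conjgM ca conjJg conjVg ca ba -conjgM -invgM.
  have c13aa : c13 ^ (a * a) = c13 ^ (c22 ^- 2).
    by rewrite conjgM c13a conjJg conjVg c13a c22a -conjgM -invgM.
  rewrite -xc [LHS]conjgM.
  have -> : x ^ (a * a) = c ^ (b ^- 2) * (c13 ^ (c22 ^- 2))^-1.
    by rewrite conjMg conjVg caa c13aa.
  move: c22c; rewrite -c13c !expgS expg0 mulg1.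
  move=> /(congr1 (fun t => c22^-1 * c * t * c^-1 * c13^-1 * c)) E.
  by transitivity (c13^-1 * c); first symmetry; [move: E|]; free_group.
(* Since [y = b * c22^-1] and [a] commutes with [z], [x ^ y] is [x ^ (z * a^-1 * c22^-1)], that is
   [x ^ (a * a * c22 * a^-1 * c22^-1)]; and [a] commutes with [c22]. *)
have xa : x ^ a = x ^ y.
  have az : a^-1 * z = z * a^-1 by rewrite -{1}(inv _ _ _ za); free_group.
  rewrite [RHS]conjgM xb az [in RHS]conjgM -xaac22 -!conjgM.
  congr (x ^ _); rewrite -{2}(inv _ _ _ c22a); free_group.
have xaV : x ^ a^-1 = x ^ y^-1 by apply: inv; rewrite conjJg xa conjVg ya conjgK.
apply: HalfRules => //.
(* Rule for [y ^ c]: as [y] and [c] act alike on [c13], moving [y] past [c13] brings out the factors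
   of [x^-1] and [x ^ c]. *)
- have c13yV : c13 ^ y^-1 = c13 ^ c^-1.
    rewrite (inv c _ (c13 ^ z^-1)); last by rewrite conjJg c13c conjVg zc conjgK.
    have -> : y^-1 = c22 * z * (z^-1 * b^-1) by free_group.
    by rewrite conjgM -c13b -conjgM -{1}zb; congr (c13 ^ _); free_group.
  transitivity (c^-1 * c13 ^ y^-1 * y * c13^-1 * c); first by free_group.
  by rewrite c13yV -xc /x; free_group.
- by rewrite xb [LHS]conjgM xaV -conjgM.
Qed.

(** Both sides of each relation are turned back into words in the six letters, whose combed forms
    coincide by computation. *)
Lemma comb_cabled_rel (H : groupType) (f : cabled -> H) :
  comb_rules (letter_val f) ->
  forall u v, cabled_rel u v -> free_lift f u = free_lift f v.
Proof.
move=> fP u v [e|e|e|e|e|e|e|e|e|e||||]; try case: e; rewrite /=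
  !(gmulfJ, gmulfM, gmulfV, gmulfR, gmulfXn) /= !free_lift_gen /commg /conjg ?expg2
  -?(cabled_lettersE f C11) -?(cabled_lettersE f C21) -?(cabled_lettersE f C12)
  -?(cabled_lettersE f C31) -?(cabled_lettersE f C22) -?(cabled_lettersE f C13)
  -?word_evalV -?word_eval_cat -?word_evalV -?word_eval_cat -?word_evalV -?word_eval_cat;
  apply: comb_inj => //; vm_compute; reflexivity.
Qed.

(** * Artin's action of the braid group on three strands *)

Lemma braid_conj (H : groupType) (s t : H) :
  s * t * s = t * s * t -> t ^ s = t * s * t^-1.
Proof. by move=> st; apply: (mulgI s); rewrite /conjg mulKVg !mulgA st mulgK. Qed.

(** In the braid group on three strands, [t * s * s * t] is one strand encircling the two that [s]
    crosses, hence the commutation with [s]. *)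
Lemma braid_conj_square (H : groupType) (s t : H) :
  s * t * s = t * s * t -> (t * s * s * t) ^ s = t * s * s * t.
Proof.
move=> st; rewrite !conjMg (braid_conj st) conjgE mulKg.
transitivity (t * s * t^-1 * s * (s * t * s) * t^-1); first by free_group.
rewrite st; transitivity (t * s * t^-1 * (s * t * s)); first by free_group.
by rewrite st; free_group.
Qed.

Section ArtinAction.
Variables (H : groupType) (s1 s2 s3 : H).
Hypotheses (s12 : s1 * s2 * s1 = s2 * s1 * s2) (s23 : s2 * s3 * s2 = s3 * s2 * s3)
  (s13 : s1 * s3 = s3 * s1).

(** In B4, [U1], [U2], [U3] are the fourth strand encircling the first one, two, three strands: a
    free basis of the kernel of the map from P4 to P3 that forgets this strand. *)
Definition artin_letters (l : letter) : H :=
  match l with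
  | U1 => s3 * s2 * s1 * s1 * s2^-1 * s3^-1
  | U2 => s3 * s2 * s1 * s1 * s2 * s3^-1
  | U3 => s3 * s2 * s1 * s1 * s2 * s3
  | V1 => s2 * s1^-1 * s1^-1 * s2^-1 * s1^-1 * s1^-1
  | V2 => s2^-1 * s1^-1 * s1^-1 * s2^-1
  | T => s1^-1 * s1^-1
  end.

Local Notation x := (artin_letters U1).
Local Notation y := (artin_letters U2).
Local Notation z := (artin_letters U3).

Let conj_eq (p q r : H) : p * q = q * r -> p ^ q = r.
Proof. by rewrite /conjg => ->; rewrite mulKg. Qed.

Let s2_s1 : s2 ^ s1 = s2 * s1 * s2^-1.
Proof. exact: braid_conj. Qed.

Let s3_s2 : s3 ^ s2 = s3 * s2 * s3^-1.
Proof. exact: braid_conj. Qed.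

Let s3_s1 : s3 ^ s1 = s3.
Proof. by apply: conj_eq. Qed.

Let D := s2 * s1 * s1 * s2.

Let D_s1 : D ^ s1 = D.
Proof. exact: braid_conj_square. Qed.

(** The full twist on three strands is the square of the half twist [P], and conjugation by [P]
    exchanges [s1] and [s2]. *)
Let fulltwist_s2 : (D * s1 * s1) ^ s2 = D * s1 * s1.
Proof.
set P := s1 * s2 * s1.
have P_s1 : P * s1 = s2 * P by rewrite /P {1}s12 !mulgA.
have P_s2 : P * s2 = s1 * P by rewrite {2}/P s12 /P !mulgA.
have -> : D * s1 * s1 = P * P.
  by rewrite {1}/P s12 -[RHS]mulgA -P_s1 /D /P; free_group.
by apply: conj_eq; rewrite -mulgA P_s2 mulgA P_s1 -mulgA.
Qed.

(** Written in [D], [s2] and [s3], of which [s1] fixes [D] and [s3], only the factor [s2^-1 * s2^-1]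
    of [x] is moved. *)
Lemma artin_s1 : [/\ x ^ s1 = y * x^-1, y ^ s1 = y & z ^ s1 = z].
Proof.
have yE : y = D ^ s3^-1 by rewrite /= /D; free_group.
have zE : z = s3 * D * s3 by rewrite /= /D; free_group.
have xE : x = (D * s2^-1 * s2^-1) ^ s3^-1 by rewrite /= /D; free_group.
split; first 1 last.
- by rewrite yE conjJg conjVg s3_s1 D_s1.
- by rewrite zE [LHS]conjMg [X in X * _]conjMg s3_s1 D_s1.
by rewrite xE yE conjJg [X in X ^ _]conjMg [X in X * _]conjMg D_s1 !conjVg s3_s1 s2_s1; free_group.
Qed.

(** Once [z] is known to be fixed, [x] and [y] are expressed through [z]: the cofactor of [x]
    commutes with [s2], and that of [y] is a power of [s3]. *)
Lemma artin_s2 : [/\ x ^ s2 = x, y ^ s2 = z * y^-1 * x & z ^ s2 = z].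
Proof.
have z_s2 : z ^ s2 = z.
  apply: conj_eq => /=.
  transitivity (s3 * s2 * s1 * s1 * (s2 * s3 * s2)); first by free_group.
  transitivity ((s2 * s3 * s2) * s1 * s1 * s2 * s3); last by free_group.
  rewrite s23 -!mulgA (mulgA s1 s3) s13 -mulgA (mulgA s1 s3) s13; free_group.
split=> //.
  have -> : x = z * (s3 * s2 * s2 * s3)^-1 by rewrite /=; free_group.
  by rewrite [LHS]conjMg conjVg z_s2 braid_conj_square.
have -> : y = z * s3^-1 * s3^-1 by rewrite /=; free_group.
by rewrite [LHS]conjMg [X in X * _]conjMg !conjVg z_s2 s3_s2 /=; free_group.
Qed.

Lemma artin_s1V : [/\ x ^ s1^-1 = x^-1 * y, y ^ s1^-1 = y & z ^ s1^-1 = z].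
Proof.
have [xs ys zs] := artin_s1; have inv (p q : H) : q ^ s1 = p -> p ^ s1^-1 = q.
  by move<-; rewrite conjgK.
by split; apply: inv => //; rewrite conjMg conjVg xs ys; free_group.
Qed.

Lemma artin_s2V : [/\ x ^ s2^-1 = x, y ^ s2^-1 = x * y^-1 * z & z ^ s2^-1 = z].
Proof.
have [xs ys zs] := artin_s2; have inv (p q : H) : q ^ s2 = p -> p ^ s2^-1 = q.
  by move<-; rewrite conjgK.
split; apply: inv => //.
by rewrite conjMg conjMg conjVg xs ys zs; free_group.
Qed.

(** [T], [V1] and [V2] are words in [s1] and [s2], so their effect on [x], [y], [z] is a composite
    of Artin's formulas. *)
Lemma artin_comb : comb_rules artin_letters.
Proof.
have [xs1V ys1V zs1V] := artin_s1V; have [xs2 ys2 zs2] := artin_s2.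
have [xs2V ys2V zs2V] := artin_s2V.
apply: half_rules_comb.
move: xs1V ys1V zs1V xs2 ys2 zs2 xs2V ys2V zs2V.
move: (artin_letters U1) (artin_letters U2) (artin_letters U3).
move=> x y z xs1V ys1V zs1V xs2 ys2 zs2 xs2V ys2V zs2V.
have inv (k p : H) : p ^ k = p -> p ^ k^-1 = p by move=> {1}<-; rewrite conjgK.
have ba : artin_letters V2 ^ artin_letters T = artin_letters V2.
  have -> : artin_letters V2 = D^-1 by rewrite /= /D; free_group.
  by rewrite conjgM conjVg (inv _ _ D_s1) conjVg (inv _ _ D_s1).
(* Hiding [_ ^ _] behind [J] keeps [conjMg] from unfolding iterated conjugates. *)
have [J JE] : exists J : H -> H -> H, forall p k, p ^ k = J p k.
  by exists (fun p k => p ^ k).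
have JM p q k : J (p * q) k = J p k * J q k by rewrite -!JE conjMg.
have JV p k : J p^-1 k = (J p k)^-1 by rewrite -!JE conjVg.
have JJ p k l : J p (k * l) = J (J p k) l by rewrite -!JE conjgM.
rewrite !JE in xs1V ys1V zs1V xs2 ys2 zs2 xs2V ys2V zs2V.
(* The product of [T] and [V2] is the inverse of the full twist, which commutes with [s1] and
   [s2]. *)
have c_ab : artin_letters V1 ^ (artin_letters T * artin_letters V2) = artin_letters V1.
  set F := D * s1 * s1.
  have -> : artin_letters T * artin_letters V2 = F^-1 by rewrite /F /D /=; free_group.
  have s1F : s1 ^ F^-1 = s1.
    by apply: inv; apply: conj_fix_sym; rewrite /F [LHS]conjMg [X in X * _]conjMg D_s1; free_group.
  have s2F : s2 ^ F^-1 = s2 by apply: inv; apply: conj_fix_sym; exact: fulltwist_s2.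
  by rewrite /= !conjMg !conjVg s1F s2F.
split=> //; last by rewrite -{2}c_ab conjgM conjgK.
all: rewrite JE [artin_letters _]/=
  !(JM, JV, JJ, xs1V, ys1V, zs1V, xs2, ys2, zs2, xs2V, ys2V, zs2V).
all: by rewrite -?JE //; free_group.
Qed.
End ArtinAction.

(** * The Schreier table of P4 in B4 *)

Definition subst (f : letter -> word letter) (w : word letter) : word letter :=
  flatten [seq if a.2 then f a.1 else word_inv (f a.1) | a <- w].

Lemma word_eval_subst (H : groupType) (v : letter -> H) f k w :
  (forall l, v l ^ k = word_eval v (f l)) ->
  word_eval v (subst f w) = word_eval v w ^ k.
Proof.
move=> fk; elim: w => [|[l e] w IHw].
  by rewrite /subst /= word_eval_nil conj1g.
rewrite word_eval_cons conjMg -IHw /subst /= word_eval_cat; congr (_ * _).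
by case: e; rewrite ?word_evalV /= -fk ?conjVg.
Qed.

(* The 24 cosets of P4 in B4, with representatives the products of a prefix of s1,
   a prefix of s2 s1 and a prefix of s3 s2 s1; see [rep]. *)
Variant coset2 := J0 | J1.
Variant coset3 := K0 | K1 | K2.
Variant coset4 := L0 | L1 | L2 | L3.

(* [sub1] and [sub2] give the conjugates of the letters by s1^-1 and s2^-1. *)
Definition sub1 (l : letter) : word letter :=
  match l with
  | U1 => [:: (U1, false); (U2, true)]
  | V1 => [:: (V2, true); (T, true); (V1, false); (T, true)]
  | _ => [:: (l, true)]
  end.

Definition sub2 (l : letter) : word letter :=
  match l with
  | U2 => [:: (U1, true); (U2, false); (U3, true)]
  | V1 => [:: (V1, true); (T, false); (V2, false); (T, true); (V2, true)]
  | V2 => [:: (T, true); (V2, true); (T, true); (V1, false)]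
  | T => [:: (V1, true); (T, false)]
  | _ => [:: (l, true)]
  end.

(** Conjugation by the inverse of a representative, which brings a word from its right to its
    left. *)
Definition carry2 (r : coset2) (w : word letter) : word letter :=
  if r is J1 then subst sub1 w else w.

Definition carry3 (q : coset3) (w : word letter) : word letter :=
  match q with
  | K0 => w
  | K1 => subst sub2 w
  | K2 => subst sub2 (subst sub1 w)
  end.

Definition step2 (r : coset2) : word letter * coset2 :=
  if r is J0 then ([::], J1) else ([:: (T, false)], J0).

(** In [pass] the braid relations move the generator, as s1, to the left of the [coset3] factor. The
    words carried are A23 and A13 here, and A34, A24 and A14 in [step]. *)
Definition step3 (k : nat) (rq : coset2 * coset3) : word letter * (coset2 * coset3) :=
  let: (r, q) := rq in
  let pass := ((step2 r).1, ((step2 r).2, q)) in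
  match q, k with
  | K0, 0%N => pass
  | K0, _ => ([::], (r, K1))
  | K1, 0%N => ([::], (r, K2))
  | K1, _ => (carry2 r [:: (V1, true); (T, false); (V2, false)], (r, K0))
  | K2, 0%N => (carry2 r [:: (T, true); (V1, false)], (r, K1))
  | K2, _ => pass
  end.

Arguments step3 : simpl never.

Definition coset := (coset2 * coset3 * coset4)%type.

(* [step k c = (w, c')] encodes [rep c * sigma_k = w * rep c'], see [stepE]. *)
Definition step (k : nat) (c : coset) : word letter * coset :=
  let: (r, q, p) := c in
  let pass k := ((step3 k (r, q)).1, ((step3 k (r, q)).2, p)) in
  let carry w := carry2 r (carry3 q w) in
  match p, k with
  | L0, 0%N => pass 0%N
  | L0, 1%N => pass 1%N
  | L0, _ => ([::], (r, q, L1))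
  | L1, 0%N => pass 0%N
  | L1, 1%N => ([::], (r, q, L2))
  | L1, _ => (carry [:: (U2, false); (U3, true)], (r, q, L0))
  | L2, 0%N => ([::], (r, q, L3))
  | L2, 1%N => (carry [:: (U1, false); (U2, true)], (r, q, L1))
  | L2, _ => pass 1%N
  | L3, 0%N => (carry [:: (U1, true)], (r, q, L2))
  | L3, 1%N => pass 0%N
  | L3, _ => pass 1%N
  end.

(** Squares of generators are pure, so generators permute the cosets by involutions. Hence
    [step_sign] can treat an inverse letter by reading the table at the target coset. *)
Lemma stepK k c : (step k (step k c).2).2 = c.
Proof. by case: c => [[[] []] []]; case: k => [|[|k]]. Qed.

Definition step_sign (a : 'I_3 * bool) (c : coset) : word letter * coset :=
  if a.2 then step a.1 c
  else let c' := (step a.1 c).2 in (word_inv (step a.1 c').1, c').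

Fixpoint run (w : word 'I_3) (c : coset) : word letter * coset :=
  if w is a :: w' then
    let: (u, c') := step_sign a c in
    let: (u', c'') := run w' c' in (u ++ u', c'')
  else ([::], c).

(* [run_far] and [run_near] are the Reidemeister-Schreier relators of P4 in B4. *)
Lemma run_far (i j : 'I_3) c : i.+1 < j ->
  comb (run [:: (i, true); (j, true)] c).1 = comb (run [:: (j, true); (i, true)] c).1
  /\ (run [:: (i, true); (j, true)] c).2 = (run [:: (j, true); (i, true)] c).2.
Proof.
case: i => [[|[|[|//]]] hi]; case: j => [[|[|[|//]]] hj] //= _.
by case: c => [[[] []] []]; split; vm_compute; reflexivity.
Qed.

Lemma run_near (i j : 'I_3) c : i.+1 = j ->
  let u := [:: (i, true); (j, true); (i, true)] in
  let u' := [:: (j, true); (i, true); (j, true)] in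
  comb (run u c).1 = comb (run u' c).1 /\ (run u c).2 = (run u' c).2.
Proof.
case: i => [[|[|[|//]]] hi]; case: j => [[|[|[|//]]] hj] //= _.
all: by case: c => [[[] []] []]; split; vm_compute; reflexivity.
Qed.

Section CosetRep.
Variables (H : groupType) (s1 s2 s3 : H).
Hypotheses (s12 : s1 * s2 * s1 = s2 * s1 * s2) (s23 : s2 * s3 * s2 = s3 * s2 * s3)
  (s13 : s1 * s3 = s3 * s1).

Local Notation v := (artin_letters s1 s2 s3).

Lemma sub1E l : v l ^ s1^-1 = word_eval v (sub1 l).
Proof.
have [xs ys zs] := artin_s1V s12 s13.
case: l => /=; rewrite !word_eval_cons word_eval_nil.
all: rewrite ?xs ?ys ?zs /=; try by free_group.
  have s1J : s1 ^ (s1 * s2)^-1 = s2 by rewrite /conjg invgK !mulgA s12; free_group.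
  transitivity ((s1^-1 * s1^-1) ^ (s1 * s2)^-1 * s1^-1 * s1^-1); first by free_group.
  by rewrite conjMg !conjVg s1J /=; free_group.
have -> : s2^-1 * s1^-1 * s1^-1 * s2^-1 = (s2 * s1 * s1 * s2)^-1 by free_group.
by rewrite conjVg -{1}(braid_conj_square s12) conjgK mulg1.
Qed.

Lemma sub2E l : v l ^ s2^-1 = word_eval v (sub2 l).
Proof.
have [xs ys zs] := artin_s2V s23 s13.
case: l => /=; rewrite !word_eval_cons word_eval_nil.
all: by rewrite ?xs ?ys ?zs /=; free_group.
Qed.

Definition rep2 (r : coset2) : H := if r is J0 then 1 else s1.
Definition rep3 (q : coset3) : H :=
  match q with K0 => 1 | K1 => s2 | K2 => s2 * s1 end.
Definition rep4 (p : coset4) : H :=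
  match p with L0 => 1 | L1 => s3 | L2 => s3 * s2 | L3 => s3 * s2 * s1 end.
Definition rep (c : coset) : H := rep2 c.1.1 * rep3 c.1.2 * rep4 c.2.

Lemma carry2E r w : word_eval v (carry2 r w) = word_eval v w ^ (rep2 r)^-1.
Proof.
by case: r; rewrite /= ?invg1 ?conjg1 // (word_eval_subst _ sub1E).
Qed.

Lemma carry3E q w : word_eval v (carry3 q w) = word_eval v w ^ (rep3 q)^-1.
Proof.
case: q; rewrite /= ?invg1 ?conjg1 ?(word_eval_subst _ sub2E) //.
by rewrite (word_eval_subst _ sub1E) invgM conjgM.
Qed.

Definition gen (k : nat) : H :=
  match k with 0%N => s1 | 1%N => s2 | _ => s3 end.

Lemma step2E r : rep2 r * s1 = word_eval v (step2 r).1 * rep2 (step2 r).2.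
Proof.
by case: r; rewrite /= ?word_eval_nil ?word_eval_seq1 /=; free_group.
Qed.

Lemma step3E k r q : k < 2 ->
  rep2 r * rep3 q * gen k =
  word_eval v (step3 k (r, q)).1
    * (rep2 (step3 k (r, q)).2.1 * rep3 (step3 k (r, q)).2.2).
Proof.
case: k => [|[|//]] _; case: q; rewrite /step3 /=.
all: rewrite ?carry2E ?word_eval_nil ?word_eval_cons ?word_eval_nil /=.
all: try by free_group.
- by rewrite mulg1 step2E; free_group.
- transitivity (rep2 r * (s2 * s1 * s2)); first by free_group.
  rewrite -s12; transitivity (rep2 r * s1 * (s2 * s1)); first by free_group.
  by rewrite step2E; free_group.
Qed.

Lemma stepE k c :
  rep c * gen k = word_eval v (step k c).1 * rep (step k c).2.
Proof.
(* A generator that the braid relations move to the left of [rep4 p] is left to the three-strand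
   table. *)
have pass j (r : coset2) (q : coset3) (p : coset4) (t : H) : j < 2 ->
    t = rep2 r * rep3 q * (gen j * rep4 p) ->
    t = word_eval v (step3 j (r, q)).1
      * (rep2 (step3 j (r, q)).2.1 * rep3 (step3 j (r, q)).2.2 * rep4 p).
  by move=> j2 ->; rewrite mulgA step3E // !mulgA.
case: c => [[r q] p]; case: k => [|[|k]]; case: p; rewrite /rep /=.
all: rewrite ?carry2E ?carry3E ?word_eval_nil ?word_eval_cons ?word_eval_nil /=.
all: try by free_group.
- by apply: (pass 0%N r q L0) => //=; free_group.
- by apply: (pass 0%N r q L1) => //=; rewrite s13; free_group.
- by apply: (pass 1%N r q L0) => //=; free_group.
- apply: (pass 0%N r q L3) => //=.
  transitivity (rep2 r * rep3 q * s3 * (s2 * s1 * s2)); first by free_group.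
  rewrite -s12; transitivity (rep2 r * rep3 q * (s3 * s1) * s2 * s1); first by free_group.
  by rewrite -s13; free_group.
- apply: (pass 1%N r q L2) => //=.
  transitivity (rep2 r * rep3 q * (s3 * s2 * s3)); first by free_group.
  by rewrite -s23; free_group.
- apply: (pass 1%N r q L3) => //=.
  transitivity (rep2 r * rep3 q * (s3 * s2) * (s1 * s3)); first by free_group.
  rewrite s13; transitivity (rep2 r * rep3 q * (s3 * s2 * s3) * s1); first by free_group.
  by rewrite -s23; free_group.
Qed.

Lemma step_signE (a : 'I_3 * bool) c :
  rep c * gen a.1 ^^ a.2 = word_eval v (step_sign a c).1 * rep (step_sign a c).2.
Proof.
case: a => k []; rewrite /step_sign /=; first exact: stepE.
have := stepE k (step k c).2; rewrite stepK word_evalV => E.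
by apply: (mulgI (word_eval v (step k (step k c).2).1)); rewrite mulKVg mulgA -E mulgK.
Qed.

(** From the trivial coset, this writes any braid as a word in the six letters times a
    representative, which yields generation of P4. *)
Lemma runE w c :
  rep c * word_eval (fun k : 'I_3 => gen k) w = word_eval v (run w c).1 * rep (run w c).2.
Proof.
elim: w c => [|a w IHw] c; first by rewrite /= !word_eval_nil mul1g mulg1.
rewrite word_eval_cons mulgA step_signE /=.
case: (step_sign a c) => u c' /=; have := IHw c'; case: (run w c') => u' c'' /= E.
by rewrite -[LHS]mulgA E word_eval_cat mulgA.
Qed.
End CosetRep.

(** * The group of bijections of a type *)

Record bij (S : Type) := Bij {
  bij_fun :> S -> S;
  bij_inv : S -> S;
  bij_funK : cancel bij_fun bij_inv;
  bij_invK : cancel bij_inv bij_fun }.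

HB.instance Definition _ (S : Type) := gen_eqMixin (bij S).
HB.instance Definition _ (S : Type) := gen_choiceMixin (bij S).

Section BijGroup.
Variable S : Type.
Implicit Types f g h : bij S.

Lemma bij_ext f g : f =1 g -> f = g.
Proof.
case: f g => [f f' fK f'K] [g g' gK g'K] /= fg.
have ff : f = g by apply: funext.
rewrite {}ff {fg} in fK f'K *.
have gg : f' = g' by apply: funext => s; rewrite -[s in LHS]g'K fK.
rewrite {}gg in fK f'K *.
by congr Bij; apply: Prop_irrelevance.
Qed.

Definition bij_one : bij S := @Bij S id id (fun=> erefl) (fun=> erefl).
(** The left factor acts first, so that homomorphisms into [bij S] are right actions, as is right
    multiplication on cosets. *)
Definition bij_mul f g : bij S :=
  @Bij S (g \o f) (bij_inv f \o bij_inv g)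
    (can_comp (@bij_funK S g) (@bij_funK S f)) (can_comp (@bij_invK S f) (@bij_invK S g)).
Definition bij_V f : bij S := Bij (@bij_invK S f) (@bij_funK S f).

Lemma bij_mulA : associative bij_mul.
Proof. by move=> f g h; apply: bij_ext. Qed.
Lemma bij_mul1 : left_id bij_one bij_mul.
Proof. by move=> f; apply: bij_ext. Qed.
Lemma bij_mulr1 : right_id bij_one bij_mul.
Proof. by move=> f; apply: bij_ext. Qed.
Lemma bij_mulV : left_inverse bij_one bij_V bij_mul.
Proof. by move=> f; apply: bij_ext => s /=; rewrite bij_invK. Qed.
Lemma bij_mulrV : right_inverse bij_one bij_V bij_mul.
Proof. by move=> f; apply: bij_ext => s /=; rewrite bij_funK. Qed.

HB.instance Definition _ :=
  isGroup.Build (bij S) bij_mulA bij_mul1 bij_mulr1 bij_mulV bij_mulrV.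

End BijGroup.

(** * The action of B4 on pairs of a group element and a coset *)

Section SchreierAction.
Variables (G : groupType) (v : letter -> G).
Hypothesis vP : comb_rules v.

(** A pair [(g, c)] stands for the formal product of [g] and the representative of [c], and
    [shift k] for right multiplication by sigma_k, as in [stepE]. *)
Definition shift (k : nat) (gc : G * coset) : G * coset :=
  (gc.1 * word_eval v (step k gc.2).1, (step k gc.2).2).

Definition unshift (k : nat) (gc : G * coset) : G * coset :=
  let c := (step k gc.2).2 in (gc.1 * (word_eval v (step k c).1)^-1, c).

Lemma shiftK k : cancel (shift k) (unshift k).
Proof. by case=> g c; rewrite /unshift /= stepK mulgK. Qed.

Lemma unshiftK k : cancel (unshift k) (shift k).
Proof. by case=> g c; rewrite /shift /unshift /= stepK mulgKV. Qed.

Definition shift_bij (k : 'I_3) : bij (G * coset) := Bij (shiftK k) (unshiftK k).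

Lemma shift_run w g c :
  word_eval shift_bij w (g, c) = (g * word_eval v (run w c).1, (run w c).2).
Proof.
elim: w g c => [|[k e] w IHw] g c; first by rewrite !word_eval_nil mulg1.
rewrite word_eval_cons /=.
have E : (shift_bij k ^^ e) (g, c) =
    (g * word_eval v (step_sign (k, e) c).1, (step_sign (k, e) c).2).
  by case: e; rewrite /step_sign /= /unshift ?word_evalV.
rewrite [LHS]/= E; case: (step_sign (k, e) c) => u c'; rewrite IHw.
by case: (run w c') => u' c''; rewrite word_eval_cat mulgA.
Qed.

Lemma shift_rel p q : @braid_rel 3 p q -> free_lift shift_bij p = free_lift shift_bij q.
Proof.
have gen2 i j : shift_bij i * shift_bij j = word_eval shift_bij [:: (i, true); (j, true)].
  by rewrite !word_eval_cons word_eval_nil mulg1.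
have gen3 i j : shift_bij i * shift_bij j * shift_bij i
    = word_eval shift_bij [:: (i, true); (j, true); (i, true)].
  by rewrite !word_eval_cons word_eval_nil mulg1 mulgA.
case=> i j ij; rewrite !free_liftM !free_lift_gen ?gen3 ?gen2; apply: bij_ext => -[g c].
  by rewrite !shift_run; have [/(comb_inj vP) -> ->] := run_far c ij.
by rewrite !shift_run; have [/(comb_inj vP) -> ->] := run_near c ij.
Qed.

Definition braid_shift (b : braidGroup 3) : bij (G * coset) := pres_lift shift_bij b.

Lemma braid_shiftM : {morph braid_shift : p q / p * q}.
Proof. exact: pres_liftM shift_rel. Qed.

Lemma braid_shift_sigma k : braid_shift (sigma k) = shift_bij k.
Proof. exact: pres_lift_gen shift_rel k. Qed.

End SchreierAction.

(** * Cabled braids in B4 and generation of P4 *)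

Lemma free_pi_eval (X : Type) (w : word X) :
  \pi_(freeGroup X)%qT w = word_eval (@free_gen X) w.
Proof.
elim: w => [|[x e] w IHw]; first by rewrite word_eval_nil.
rewrite word_eval_cons -IHw.
have -> : free_gen x ^^ e = \pi_(freeGroup X)%qT ([:: (x, e)] : word X).
  by case: e => //; rewrite [LHS]free_inv_pi.
by rewrite [RHS]free_mul_pi.
Qed.

Lemma free_lift_pres_gen (X : Type) (R : freeGroup X -> freeGroup X -> Prop) p :
  free_lift (pres_gen R) p = quo_pi R p.
Proof.
elim/quotW: p => w; rewrite free_lift_pi free_pi_eval.
elim: w => [|[x e] w IHw]; first by rewrite !word_eval_nil gmulf1.
rewrite !word_eval_cons quo_piM IHw; congr (_ * _); case: e => //=.
by rewrite gmulfV.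
Qed.

Definition o1 : 'I_3 := Ordinal (isT : 0 < 3).
Definition o2 : 'I_3 := Ordinal (isT : 1 < 3).
Definition o3 : 'I_3 := Ordinal (isT : 2 < 3).

Local Notation s1 := (sigma o1).
Local Notation s2 := (sigma o2).
Local Notation s3 := (sigma o3).

Lemma sigma_gen (k : 'I_3) : gen s1 s2 s3 k = sigma k.
Proof. by case: k => [[|[|[|//]]] hk] /=; congr sigma; apply: val_inj. Qed.

Lemma sigma_near (i j : 'I_3) : i.+1 = j ->
  sigma i * sigma j * sigma i = sigma j * sigma i * sigma j.
Proof. by move=> /braid_rel_near/quo_pi_rel; rewrite !quo_piM. Qed.

Lemma sigma_far (i j : 'I_3) : i.+1 < j -> sigma i * sigma j = sigma j * sigma i.
Proof. by move=> /braid_rel_far/quo_pi_rel; rewrite !quo_piM. Qed.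

Lemma cabled_artin : letter_val cabled_braid = artin_letters s1 s2 s3.
Proof.
apply: funext => -[]; rewrite /= /A12 /A13 /A14 /A23 /A24 /A34 !expg2 -/o1 -/o2 -/o3.
all: by free_group.
Qed.

Lemma cabled_braid_comb : comb_rules (letter_val cabled_braid).
Proof.
by rewrite cabled_artin; apply: artin_comb; [apply: sigma_near|apply: sigma_near|apply: sigma_far].
Qed.

(* Here [a12] is a word for A12^-1, and similarly for the others. *)
Definition cabled_word (c : cabled) : word 'I_3 :=
  let p := map (fun k => (k, true)) in
  let n := map (fun k => (k, false)) in
  let a12 := n [:: o1; o1] in
  let a23 := n [:: o2; o2] in
  let a34 := n [:: o3; o3] in
  let a13 := p [:: o2] ++ a12 ++ n [:: o2] in
  let a24 := p [:: o3] ++ a23 ++ n [:: o3] in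
  let a14 := p [:: o3] ++ a13 ++ n [:: o3] in
  match c with
  | C11 => a12
  | C21 => a23 ++ a13
  | C12 => a13 ++ a12
  | C31 => a34 ++ a24 ++ a14
  | C22 => a24 ++ a14 ++ a23 ++ a13
  | C13 => a14 ++ a13 ++ a12
  end.

Lemma cabled_wordE c : word_eval (@sigma 3) (cabled_word c) = cabled_braid c.
Proof.
case: c; rewrite /= /A12 /A13 /A14 /A23 /A24 /A34 !expg2
  !word_eval_cons word_eval_nil /= -/o1 -/o2 -/o3.
all: by free_group.
Qed.

Definition coset1 : coset := (J0, K0, L0).

(** This makes a cabled braid act on pairs over the trivial coset as right multiplication by its own
    generator. *)
Lemma run_cabled c :
  comb (run (cabled_word c) coset1).1 = comb (cabled_letters c)
  /\ (run (cabled_word c) coset1).2 = coset1.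
Proof. by case: c; split; vm_compute; reflexivity. Qed.

Lemma rep_perm c : braid_perm (rep s1 s2 s3 c) = 1 -> c = coset1.
Proof.
case: c => [[r q] p]; rewrite /rep !braid_permM.
have perm1 := morph_mul1 (@braid_permM 3).
move=> /permP E.
have Ei (i : 'I_4) := congr1 val (E i).
(* A permutation of four points that fixes three of them is trivial, so three values rule out the
   other 23 cosets. *)
move: (Ei (Ordinal (isT : 0 < 4))) (Ei (Ordinal (isT : 1 < 4))) (Ei (Ordinal (isT : 2 < 4))).
case: r {E Ei}; case: q; case: p => //=.
all: by rewrite ?braid_permM ?perm1 ?braid_perm_sigma /adj_tperm; do 8?rewrite ?permM ?permE /=.
Qed.

Lemma cabled_braid_pure c : braid_perm (cabled_braid c) = 1.
Proof.
have sq i : braid_perm (sigma i : braidGroup 3) * braid_perm (sigma i) = 1.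
  by rewrite braid_perm_sigma tperm2.
have inv i : (braid_perm (sigma i : braidGroup 3))^-1 = braid_perm (sigma i).
  by rewrite braid_perm_sigma tpermV.
have sqK i p : p * braid_perm (sigma i : braidGroup 3) * braid_perm (sigma i) = p.
  by rewrite -mulgA sq mulg1.
have permV := morph_mulV (@braid_permM 3).
case: c; rewrite /= /A12 /A13 /A14 /A23 /A24 /A34 !expg2
  !(@braid_permM 3, permV, invgM, inv, invgK, mulgA) ?(inv, sqK, sq, mulgA, mul1g) //.
Qed.

Lemma free_lift_cabled_pure w : braid_perm (free_lift cabled_braid w) = 1.
Proof.
elim/quotW: w => u; rewrite free_lift_pi (morph_word_eval _ _ (@braid_permM 3)).
elim: u => [|[c e] u IHu]; first by rewrite word_eval_nil.
by rewrite word_eval_cons IHu mulg1 /= cabled_braid_pure; case: e; rewrite //= invg1.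
Qed.

Lemma sigma_word (b : braidGroup 3) : exists u, b = word_eval (@sigma 3) u.
Proof.
elim/quotW: b => p; elim/quotW: p => u; exists u.
by rewrite -free_lift_pi free_lift_pres_gen.
Qed.

Lemma free_lift_letters (H : groupType) (f : cabled -> H) w :
  free_lift f (word_eval (letter_val (@free_gen cabled)) w) = word_eval (letter_val f) w.
Proof.
rewrite (morph_word_eval _ _ (free_liftM f)); congr word_eval.
by apply: funext => -[]; rewrite /= ?gmulfM ?gmulfV /= ?free_lift_gen.
Qed.

(** Rewriting gives [b] as a product of cabled generators times a representative; this
    representative is then pure, hence trivial by [rep_perm]. *)
Lemma pure_braid_cabled b : braid_perm b = 1 -> exists w, free_lift cabled_braid w = b.
Proof.
have [u ->] := sigma_word b.
have := runE (sigma_near (erefl : o1.+1 = o2)) (sigma_near (erefl : o2.+1 = o3))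
  (sigma_far (isT : o1.+1 < o3)) u coset1.
have -> : (fun k : 'I_3 => gen s1 s2 s3 k) = @sigma 3 by apply: funext => k; apply: sigma_gen.
rewrite [rep _ _ _ coset1]/rep /= !mul1g -cabled_artin -free_lift_letters => E bP.
move: E (bP); case: (run u coset1) => w c /= ->.
rewrite braid_permM free_lift_cabled_pure mul1g => /rep_perm ->.
by rewrite /rep /= !mulg1; eexists.
Qed.

(** * Faithfulness of the action and the presentation *)

Section Faithful.
Variables (G : groupType) (f : cabled -> G).
Hypothesis fP : comb_rules (letter_val f).

Lemma braid_shift_cabled c e g :
  braid_shift (letter_val f) (cabled_braid c ^^ e) (g, coset1) = (g * f c ^^ e, coset1).
Proof.
have pos h : braid_shift (letter_val f) (cabled_braid c) (h, coset1) = (h * f c, coset1).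
  rewrite -cabled_wordE (morph_word_eval _ _ (braid_shiftM fP)).
  have -> : braid_shift (letter_val f) \o @sigma 3 = shift_bij (letter_val f).
    by apply: funext => k; apply: (braid_shift_sigma fP).
  rewrite shift_run; have [/(comb_inj fP) -> ->] := run_cabled c.
  by rewrite cabled_lettersE.
case: e => /=; first exact: pos.
rewrite (morph_mulV (braid_shiftM fP)) /=.
by rewrite -{1}[g](mulgKV (f c)) -pos bij_funK.
Qed.

Lemma braid_shift_lift w g :
  braid_shift (letter_val f) (free_lift cabled_braid w) (g, coset1) = (g * free_lift f w, coset1).
Proof.
elim/quotW: w g => u g; rewrite !free_lift_pi; elim: u g => [|[c e] u IHu] g.
  by rewrite !word_eval_nil (morph_mul1 (braid_shiftM fP)) mulg1.
rewrite !word_eval_cons (braid_shiftM fP) mulgA -IHu.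
exact: congr1 (braid_shift_cabled c e g).
Qed.

Lemma cabled_lift_faithful w : free_lift cabled_braid w = 1 -> free_lift f w = 1.
Proof.
move=> w1; have := braid_shift_lift w 1.
by rewrite w1 (morph_mul1 (braid_shiftM fP)) mul1g => -[].
Qed.
End Faithful.

Theorem proposition4p1 :
  presented_by (@pure_braid 3) cabled_braid cabled_rel.
Proof.
have lift_rel := comb_cabled_rel cabled_braid_comb.
split=> [b|w]; last first.
  split=> [w1|]; last exact: normal_closure_ker.
  (* Faithfulness is applied to the presented group itself, in which the cabled relations hold by
     construction. *)
  apply/quo_pi_eq1; rewrite -free_lift_pres_gen; apply: cabled_lift_faithful w1.
  by apply: cabled_rel_comb => u v uv; rewrite !free_lift_pres_gen; apply: quo_pi_rel.
split=> [|[w <-]]; rewrite inE; first by move/eqP; apply: pure_braid_cabled.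
by apply/eqP; apply: free_lift_cabled_pure.
Qed.
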